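(* Let $n\ge 1$ be an integer, let $\alpha, c$ be real numbers, and let $OX_n$ be the oxide network of dimension $n$. Then $$\Pi_{1,c}(OX_n)=2^{18n^2c},$$ $$\Pi_2(OX_n)=2^{72n^2-12n},$$ $$\chi_\alpha(OX_n)=n\,2^{\alpha+2}3^{\alpha+1}+3n(3n-2)2^{3\alpha+1},$$ $$\Pi_1^*(OX_n)=2^{54n^2-24n}\,3^{12n}.$$
   Context: All graphs are finite, simple and connected; $d(v)$ is the degree of the vertex $v$ in $G=(V(G),E(G))$. For real $c,\alpha$ define $$\Pi_{1,c}(G)=\prod_{v\in V(G)}d(v)^c,\quad \Pi_2(G)=\prod_{uv\in E(G)}d(u)d(v)=\prod_{u\in V(G)}d(u)^{d(u)},$$ $$\Pi_1^*(G)=\prod_{uv\in E(G)}(d(u)+d(v)),\quad \chi_\alpha(G)=\sum_{uv\in E(G)}(d(u)+d(v))^\alpha.$$ Honeycomb network $HC_n$: $HC_1$ is a hexagon (6-cycle), and $HC_n$ is obtained from $HC_{n-1}$ by adding a layer of hexagons of the regular hexagonal tiling of the plane around the boundary of $HC_{n-1}$. Equivalently, $HC_n$ consists of the vertices and edges of all hexagons of the tiling at distance at most $n-1$ from a fixed central hexagon, where distance is the graph distance in which two hexagons are adjacent when they share an edge. Silicate network $SL_n$: start from $HC_n$ and call its vertices silicon vertices. Put one oxygen vertex on each edge of $HC_n$ (it is associated with the two silicon vertices that are endpoints of that edge), and for each of the $6n$ vertices of degree 2 of $HC_n$ add one further oxygen vertex associated only with that silicon vertex. Each silicon vertex then has exactly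 three associated oxygen vertices. The vertices of $SL_n$ are all silicon and oxygen vertices, and the edges are those making each silicon vertex together with its three associated oxygen vertices a complete graph $K_4$, with no other edges. Oxide network $OX_n$: the graph obtained from $SL_n$ by deleting all silicon vertices (and their incident edges). Thus $|V(OX_n)|=9n^2+3n$ and $|E(OX_n)|=18n^2$. *)

(* Defs.v *)
From mathcomp Require Import all_boot all_order all_algebra.
From mathcomp Require Import reals exp.

Set Implicit Arguments.
Unset Strict Implicit.
Unset Printing Implicit Defensive.

Import Order.TTheory GRing.Theory Num.Theory.
Local Open Scope ring_scope.

Record sgraph := SGraph {
  vertex :> finType;
  adj : rel vertex;
  adj_sym : symmetric adj;
  adj_irr : irreflexive adj }.

Section Graph.
Variable G : sgraph.

Definition degree (v : G) : nat := #|[set u | adj v u]|.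

Definition edges : {set {set G}} :=
  [set [set u; v] | u in G, v in adj u].

End Graph.

Section Induced.
Variables (G : sgraph) (P : pred G).

Definition induced_adj : rel {x : G | P x} := fun x y => adj (val x) (val y).

Lemma induced_sym : symmetric induced_adj.
Proof. by move=> x y; apply: adj_sym. Qed.

Lemma induced_irr : irreflexive induced_adj.
Proof. by move=> x; apply: adj_irr. Qed.

Definition induced : sgraph := SGraph induced_sym induced_irr.

End Induced.

(* Every edge e is a pair [set u; v] with u != v, so a sum or product over the
   elements u of e has exactly the two terms given by the ends of e. *)
Section Indices.
Variables (R : realType) (G : sgraph).

Definition Pi1 (c : R) : R := \prod_(v : G) (degree v)%:R `^ c.

Definition Pi2 : nat := (\prod_(e in edges G) \prod_(u in e) degree u)%N.

Definition Pi1star : nat := (\prod_(e in edges G) \sum_(u in e) degree u)%N.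

Definition chi (alpha : R) : R :=
  \sum_(e in edges G) (\sum_(u in e) degree u)%N%:R `^ alpha.

End Indices.

(* The pair (x, y) stands for the point x + y * exp(i pi / 3) of the triangular
   lattice. The points with x = y mod 3 are the centres of the cells of a
   regular hexagonal tiling, whose vertices are all the other points. *)
Definition point : Type := (int * int)%type.

(* The six unit vectors, in counterclockwise order. *)
Definition dir (k : 'I_6) : point :=
  tnth [tuple (1, 0); (0, 1); (-1, 1); (-1, 0); (0, -1); (1, -1)] k.

Definition corner (h : point) (k : 'I_6) : point := h + dir k.

(* ordS is the cyclic successor on 'I_6. The hexagon centred at h has the sides
   joining corner h k to corner h (ordS k). *)
Definition across (h : point) (k : 'I_6) : point := h + dir k + dir (ordS k).

(* The hexagons across h k are those which share a side with that of centre h;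
   a common side is traversed in opposite directions by its two hexagons. *)
Lemma acrossP (h h' : point) :
  (exists k, h' = across h k) <->
  (exists k l, corner h' l = corner h (ordS k) /\
               corner h' (ordS l) = corner h k).
Proof.
have opp k : exists l, dir l = - dir k /\ dir (ordS l) = - dir (ordS k).
  exists (ordS (ordS (ordS k))).
  by case: k => -[|[|[|[|[|[|//]]]]]] ?; split; apply/eqP.
split=> [[k ->]|[k [l [e1 e2]]]].
  exists k; have [l [l1 l2]] := opp k; exists l.
  by rewrite /corner /across l1 l2 addrAC !addrK.
exists k.
have dl : dir l = - dir k.
  have : dir l - dir (ordS l) = dir (ordS k) - dir k.
    have := congr2 (fun x y => x - y) e1 e2.
    by rewrite /corner !opprD ![_ + (- _ - _)]addrACA !subrr !add0r.
  case: k l {e1 e2} => -[|[|[|[|[|[|//]]]]]] ? [[|[|[|[|[|[|//]]]]]] ?] /eqP //;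
    by move=> _; apply/eqP.
by rewrite /across addrAC -[h + dir (ordS k)]/(corner h (ordS k)) -e1 /corner dl subrK.
Qed.

Definition add_layer (s : seq point) : seq point :=
  s ++ [seq across h k | h <- s, k <- enum 'I_6].

(* The centres of the hexagons of HC_n, for n >= 1. *)
Definition cells (n : nat) : seq point := iter n.-1 add_layer [:: (0, 0)].

Section Honeycomb.
Variable n : nat.

Definition hc_vertex : finType :=
  seq_sub [seq corner h k | h <- cells n, k <- enum 'I_6].

Definition hc_side (u v : hc_vertex) : bool :=
  has (fun h => [exists k, (val u == corner h k) && (val v == corner h (ordS k))])
      (cells n).

Definition hc_adj : rel hc_vertex := fun u v => hc_side u v || hc_side v u.

Lemma hc_sym : symmetric hc_adj.
Proof. by move=> u v; rewrite /hc_adj orbC. Qed.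

Lemma hc_irr : irreflexive hc_adj.
Proof.
move=> u; rewrite /hc_adj orbb; apply/negbTE/hasPn => h _.
apply/existsPn => k; apply/negP => /andP[/eqP-> /eqP/addrI].
by case: k => -[|[|[|[|[|[|//]]]]]] ?.
Qed.

Definition honeycomb : sgraph := SGraph hc_sym hc_irr.

End Honeycomb.

Section Silicate.
Variable G : sgraph.

Definition oxygen : finType :=
  ({e : {set G} | e \in edges G} + {v : G | degree v == 2%N})%type.

Definition associated (s : G) (o : oxygen) : bool :=
  match o with
  | inl e => s \in val e
  | inr v => s == val v
  end.

(* The left summand consists of the silicon vertices. *)
Definition sl_vertex : finType := (G + oxygen)%type.

Definition is_silicon (x : sl_vertex) : bool := if x is inl _ then true else false.

Definition tetrahedron (s : G) : {set sl_vertex} :=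
  inl s |: [set inr o | o : oxygen & associated s o].

Definition sl_adj : rel sl_vertex := fun x y =>
  (x != y) && [exists s, (x \in tetrahedron s) && (y \in tetrahedron s)].

Lemma sl_sym : symmetric sl_adj.
Proof.
by move=> x y; rewrite /sl_adj eq_sym; under eq_existsb do rewrite andbC.
Qed.

Lemma sl_irr : irreflexive sl_adj.
Proof. by move=> x; rewrite /sl_adj eqxx. Qed.

Definition silicate_of : sgraph := SGraph sl_sym sl_irr.

End Silicate.

Definition silicate (n : nat) : sgraph := silicate_of (honeycomb n).

Definition oxide (n : nat) : sgraph :=
  @induced (silicate n) (fun x => ~~ is_silicon x).

(* Main.v *)
Require Import Defs.
From mathcomp Require Import all_boot all_order all_algebra.
From mathcomp Require Import reals exp.
From mathcomp Require Import zify ring.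

(** The oxygens around a silicon are pairwise adjacent, and two distinct oxygens
   share at most one silicon; so an oxygen has two neighbours for each silicon
   it is associated with. In the oxide graph of any graph with all degrees 2
   or 3, an oxygen on an edge therefore has degree 4 and a pendant oxygen, one
   added at a vertex of degree 2, has degree 2 ([degree_ox]), and pendant
   oxygens are never adjacent. Counting incidences between edges and pendant
   oxygens, and between edges and all oxygens, gives the number of edges with
   end degrees 2 and 4 and of those with end degrees 4 and 4 ([big_edges24]).
   All four indices then depend only on two numbers: the vertices of degree 2
   and the edges of the honeycomb.

   These two numbers are found by cutting the honeycomb into six sectors
   ([vertex_at_bij]). Put the centre of the central cell at the origin. One
   sector consists of the corners in the direction 1 of the cells reached from
   the central one by a < n steps in the direction exp (i pi / 6) and b < n
   steps in the direction - i; the six rotations of this sector cover every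
   vertex exactly once. Hence the vertices are indexed by a rotation k < 6 and two
   coordinates a, b < n. Inside a sector the three neighbours are explicit, and
   one of them is missing precisely when a = n - 1 ([sector_nbrsP]). So 6n
   vertices have degree 2 and the other 6n(n - 1) have degree 3, and the
   handshake lemma gives 9n^2 - 3n edges. *)

Set Implicit Arguments.
Unset Strict Implicit.
Unset Printing Implicit Defensive.

Import Order.TTheory GRing.Theory Num.Theory.

(** * Edges and degrees *)

Section DoubleCounting.
Variable G : sgraph.

Lemma adj_neq (x y : G) : adj x y -> x != y.
Proof. by apply: contraTneq => ->; rewrite adj_irr. Qed.

Lemma edgesP (e : {set G}) :
  reflect (exists x y : G, adj x y /\ e = [set x; y]) (e \in edges G).
Proof.
apply: (iffP imset2P) => [[x y _ xy ->]|[x [y [xy ->]]]]; first by exists x, y.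
by exists x y.
Qed.

Lemma mem_edges (x y : G) : adj x y -> [set x; y] \in edges G.
Proof. by move=> xy; apply/edgesP; exists x, y. Qed.

Lemma big_edge T (idx : T) (op : Monoid.com_law idx) (f : G -> T) (x y : G) :
  adj x y -> \big[op/idx]_(u in [set x; y]) f u = op (f x) (f y).
Proof.
by move=> /adj_neq xy; rewrite big_setU1 ?inE // big_set1.
Qed.

Lemma card_edges_at (u : G) : #|[set e in edges G | u \in e]| = degree u.
Proof.
rewrite /degree -(@card_in_imset _ _ (fun v => [set u; v])).
  apply: eq_card => e; rewrite inE; apply/andP/imsetP => [[/edgesP]|[v]].
    move=> [x [y [xy ->]]]; rewrite !inE => /orP[/eqP->|/eqP->].
      by exists y; rewrite ?inE.
    by exists x; rewrite ?inE 1?adj_sym // setUC.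
  by rewrite inE => uv ->; rewrite mem_edges // !inE eqxx.
move=> v w; rewrite !inE => /adj_neq uv /adj_neq uw.
move/setP/(_ v); rewrite !inE eqxx orbT eq_sym (negPf uv) /=.
by move/esym/eqP.
Qed.

(** Each vertex u is counted once for every edge through it. Taking f constant
   gives the handshake lemma; taking f the indicator of a set of vertices
   counts the edges which meet this set. *)
Lemma sum_edges_ends (f : G -> nat) :
  (\sum_(e in edges G) \sum_(u in e) f u = \sum_u degree u * f u)%N.
Proof.
rewrite (exchange_big_dep predT) //=; apply: eq_bigr => u _.
by rewrite -card_edges_at -sum_nat_const; apply: eq_bigl => e; rewrite inE.
Qed.

Lemma handshake : (2 * #|edges G| = \sum_(u : G) degree u)%N.
Proof.
under [RHS]eq_bigr do rewrite -[degree _]muln1.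
rewrite -(sum_edges_ends (fun=> 1%N)) mulnC -sum_nat_const.
by apply: eq_bigr => _ /edgesP[x [y [xy ->]]]; rewrite big_edge.
Qed.

End DoubleCounting.

Section DegreesTwoFour.
Variable H : sgraph.
Hypothesis degree24 : forall x : H, (degree x == 2) || (degree x == 4).
Hypothesis degree2_indep : forall x y : H,
  adj x y -> degree x = 2 -> degree y = 4.

Let n2 := #|[set x : H | degree x == 2]|.
Let n4 := #|[set x : H | degree x == 4]|.

Lemma big_degree24 T (idx : T) (op : Monoid.com_law idx) (f : nat -> T) :
  \big[op/idx]_(x : H) f (degree x)
    = op (iter n2 (op (f 2)) idx) (iter n4 (op (f 4)) idx).
Proof.
rewrite (bigID (fun x : H => degree x == 2)) /= -!big_const.
congr (op _ _); apply: eq_big => x.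
- by rewrite inE.
- by move=> /eqP->.
- by rewrite inE; case/orP: (degree24 x) => /eqP->.
- by case/orP: (degree24 x) => /eqP->.
Qed.

Lemma sum_degree24 (f : nat -> nat) :
  \sum_(x : H) f (degree x) = n2 * f 2 + n4 * f 4.
Proof. by rewrite big_degree24 /= !iter_addn_0 ![f _ * _]mulnC. Qed.

(** Since no edge joins two vertices of degree 2, the edges which meet them
   number 2 * n2; the handshake lemma gives n2 + 2 * n4 edges altogether. One
   statement about an arbitrary commutative operation serves both the sums and
   the products over edges. *)
Lemma big_edges24 T (idx : T) (op : Monoid.com_law idx) (F : {set H} -> T) a b :
    (forall x y, adj x y -> degree x = 2 -> degree y = 4 -> F [set x; y] = a) ->
    (forall x y, adj x y -> degree x = 4 -> degree y = 4 -> F [set x; y] = b) ->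
  \big[op/idx]_(e in edges H) F e
    = op (iter (2 * n2) (op a) idx) (iter (2 * n4 - n2) (op b) idx).
Proof.
move=> Fa Fb.
pose n_low (e : {set H}) : nat := \sum_(u in e) (degree u == 2).
have edge24 e : e \in edges H ->
    n_low e = 1%N /\ F e = a \/ n_low e = 0%N /\ F e = b.
  move=> /edgesP[x [y [xy ->]]]; rewrite /n_low big_edge //.
  case/orP: (degree24 x) => /eqP dx.
    have dy := degree2_indep xy dx.
    by left; rewrite dx dy (Fa x y).
  case/orP: (degree24 y) => /eqP dy; last by right; rewrite dx dy (Fb x y).
  by left; rewrite dx dy setUC (Fa y x) // adj_sym.
have card_low : #|[set e in edges H | n_low e == 1%N]| = (2 * n2)%N.
  have := sum_edges_ends (fun u : H => nat_of_bool (degree u == 2)).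
  rewrite (sum_degree24 (fun d => d * (d == 2))%N) /=.
  rewrite !(muln0, addn0, muln1) mulnC => <-.
  rewrite -sum1dep_card big_mkcondr; apply: eq_bigr => e eH.
  by rewrite -/(n_low e); case: (edge24 e eH) => -[-> _].
have card_high : #|[set e in edges H | n_low e != 1%N]| = (2 * n4 - n2)%N.
  have total : #|[set e in edges H | n_low e == 1%N]|
             + #|[set e in edges H | n_low e != 1%N]| = #|edges H|.
    rewrite -(cardsID [set e | n_low e == 1%N] (edges H)).
    by congr (_ + _); apply: eq_card => e; rewrite !inE // andbC.
  have arith E A B N M :
    2 * E = N * 2 + M * 4 -> A = 2 * N -> A + B = E -> B = 2 * M - N by lia.
  exact: arith (etrans (handshake H) (sum_degree24 id)) card_low total.
rewrite (bigID (fun e => n_low e == 1%N)) /= -card_low -card_high -!big_const.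
congr (op _ _); apply: eq_big => e; rewrite ?inE // => /andP[eH].
  by case: (edge24 e eH) => -[-> ->].
by case: (edge24 e eH) => -[-> ->].
Qed.

End DegreesTwoFour.

(** * The oxide graph of a graph with degrees 2 and 3 *)

Section Oxide.
Variable G : sgraph.
Hypothesis degree23 : forall s : G, (degree s == 2) || (degree s == 3).

Definition oxide_of : sgraph :=
  @induced (silicate_of G) (fun x => ~~ is_silicon x).

Definition ox (o : oxygen G) : oxide_of :=
  exist (fun x : silicate_of G => ~~ is_silicon x) (inr o) isT.

Definition unox (x : oxide_of) : oxygen G :=
  match x with
  | exist (inr o) _ => o
  | exist (inl _) silicon => match notF silicon with end
  end.

Lemma oxK : cancel ox unox. Proof. by []. Qed.

Lemma unoxK : cancel unox ox.
Proof. by case=> -[//|o] p; apply: val_inj. Qed.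

Lemma adj_ox (o o' : oxygen G) :
  adj (ox o) (ox o') = (o != o') && [exists s, associated s o && associated s o'].
Proof.
have inr_tetra s p : (inr p \in tetrahedron s) = associated s p.
  by rewrite !inE /= mem_imset ?inE // => ? ? [].
rewrite /= /induced_adj /= /sl_adj; congr (~~ _ && _).
by apply: eq_existsb => s; rewrite !inr_tetra.
Qed.

(** An edge is determined by its two ends, and a pendant oxygen has only one
   silicon. *)
Lemma associated_inj (s t : G) (o o' : oxygen G) : o != o' ->
  associated s o -> associated s o' -> associated t o -> associated t o' -> s = t.
Proof.
case: o o' => [e|v] [e'|v'] //=; last by move=> _ /eqP-> _ /eqP->.
- move=> ne se se' te te'; apply: contraNeq ne => st.
  have edge_st (d : {e : {set G} | e \in edges G}) :
      s \in val d -> t \in val d -> val d = [set s; t].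
    have /edgesP[x [y [_ ->]]] := valP d; move: st; rewrite !inE.
    move=> st /orP[]/eqP sE /orP[]/eqP tE; move: st; rewrite sE tE ?eqxx //.
    by rewrite setUC.
  have -> : e = e' by apply: val_inj; rewrite (edge_st e se te) (edge_st e' se' te').
  exact: eqxx.
- by move=> _ _ /eqP-> _ /eqP->.
- by move=> _ /eqP-> _ /eqP->.
Qed.

(** The extra oxygen makes up for the missing edge of a vertex of degree 2. *)
Lemma card_oxygens_at (s : G) : #|[set o | associated s o]| = 3.
Proof.
rewrite -sum1dep_card big_mkcond big_sumType /=.
rewrite -(big_sub (fun e => e \in edges G) (fun e => if s \in e then 1%N else 0%N)).
rewrite -(big_sub (fun v => degree v == 2) (fun v => if s == v then 1%N else 0%N)).
rewrite -big_mkcondr sum1dep_card card_edges_at -big_mkcondr sum1dep_card.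
have -> : [set v : G | (degree v == 2) && (s == v)]
          = if degree s == 2 then [set s] else set0.
  apply/setP => v; rewrite inE; case: (eqVneq s v) => [<-|sv].
    by rewrite andbT; case: ifP; rewrite ?inE ?eqxx.
  by rewrite andbF; case: ifP => _; rewrite !inE // eq_sym (negPf sv).
by case/orP: (degree23 s) => /eqP->; rewrite ?cards1 ?cards0.
Qed.

(** Each silicon of o contributes its two other oxygens as neighbours of o, and
   by [associated_inj] no neighbour is contributed twice. *)
Lemma degree_ox (o : oxygen G) : degree (ox o) = (2 * #|[set s | associated s o]|)%N.
Proof.
have -> : degree (ox o) = \sum_o' (adj (ox o) (ox o') : nat).
  rewrite /degree -sum1dep_card big_mkcond (reindex ox) /=.
    by apply: eq_bigr => o' _; case: ifP.
  by exists unox => x _; rewrite ?oxK ?unoxK.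
have adj_sum o' :
    (adj (ox o) (ox o') : nat)
    = \sum_(s | associated s o) ((o != o') && associated s o').
  rewrite adj_ox; have [->|oo'] /= := eqVneq o o'; first by rewrite big1.
  case: existsP => [[s /andP[so so']]|none].
    rewrite (bigD1 s) //= so' big1 // => t /andP[to ts].
    apply/eqP; rewrite eqb0; apply: contraNN ts => to'.
    by apply/eqP; apply: associated_inj oo' _ _ _ _.
  rewrite big1 // => s so; apply/eqP; rewrite eqb0; apply/negP => so'.
  by apply: none; exists s; rewrite so.
rewrite (eq_bigr _ (fun o' _ => adj_sum o')) exchange_big /= mulnC -sum_nat_const.
apply: eq_big => s; rewrite ?inE // => so.
have := cardsD1 o [set o' | associated s o'].
rewrite card_oxygens_at inE so add1n => -[others].
rewrite [RHS]others -sum1_card [RHS]big_mkcond; apply: eq_bigr => o' _.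
by rewrite !inE eq_sym; case: ifP.
Qed.

Lemma degree_bridge (e : {e : {set G} | e \in edges G}) :
  degree (ox (inl e)) = 4.
Proof.
rewrite degree_ox; have -> : [set s | associated s (inl e)] = val e.
  by apply/setP => s; rewrite inE.
have /edgesP[x [y [/adj_neq xy ->]]] := valP e.
by rewrite cards2 xy.
Qed.

Lemma degree_pendant (v : {v : G | degree v == 2}) : degree (ox (inr v)) = 2.
Proof.
rewrite degree_ox; have -> : [set s | associated s (inr v)] = [set val v].
  by apply/setP => s; rewrite !inE.
by rewrite cards1.
Qed.

Lemma oxide_degree24 (x : oxide_of) : (degree x == 2) || (degree x == 4).
Proof.
by rewrite -(unoxK x); case: (unox x) => o; rewrite ?degree_bridge ?degree_pendant.
Qed.

Lemma oxide_degree2_indep (x y : oxide_of) :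
  adj x y -> degree x = 2 -> degree y = 4.
Proof.
rewrite -(unoxK x) -(unoxK y).
case: (unox x) (unox y) => [e|v] [e'|v']; rewrite ?degree_bridge //.
rewrite adj_ox => /andP[vv' /existsP[s /= /andP[/eqP sv /eqP sv']]].
by case/eqP: vv'; congr inr; apply: val_inj; apply: etrans (esym sv) sv'.
Qed.

Lemma card_oxide_degree4 : #|[set x : oxide_of | degree x == 4]| = #|edges G|.
Proof.
rewrite -sum1dep_card (reindex ox) /=; last first.
  by exists unox => x _; rewrite ?oxK ?unoxK.
rewrite big_mkcond big_sumType /= [X in (_ + X)%N]big1 ?addn0; last first.
  by move=> v _; rewrite degree_pendant.
under eq_bigr do rewrite degree_bridge /=.
by rewrite sum1_card card_sig.
Qed.

Lemma card_oxide_degree2 :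
  #|[set x : oxide_of | degree x == 2]| = #|[set v : G | degree v == 2]|.
Proof.
rewrite -sum1dep_card (reindex ox) /=; last first.
  by exists unox => x _; rewrite ?oxK ?unoxK.
rewrite big_mkcond big_sumType /= [X in (X + _)%N]big1 ?add0n; last first.
  by move=> e _; rewrite degree_bridge.
under eq_bigr do rewrite degree_pendant /=.
by rewrite sum1_card card_sig cardsE.
Qed.

End Oxide.

(** * Cells and corners of the honeycomb *)

Local Open Scope ring_scope.

(** Multiplication by exp (i pi / 3), in the coordinates x + y exp (i pi / 3). *)
Definition rot (p : point) : point := (- p.2, p.1 + p.2).

Lemma rotD p q : rot (p + q) = rot p + rot q.
Proof. by rewrite /rot /= opprD addrACA. Qed.

Lemma rot6 p : iter 6 rot p = p.
Proof. by case: p => x y; congr pair => /=; lia. Qed.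

Lemma dir_ordS k : dir (ordS k) = rot (dir k).
Proof. by case: k => -[|[|[|[|[|[|//]]]]]] ?; apply/eqP. Qed.

Lemma dir_iter k : dir k = iter k rot (dir ord0).
Proof. by case: k => -[|[|[|[|[|[|//]]]]]] ?; apply/eqP. Qed.

Lemma iter_rotD k p q : iter k rot (p + q) = iter k rot p + iter k rot q.
Proof. by elim: k => //= k ->; rewrite rotD. Qed.

(** Multiplication by 1 + exp (i pi / 3), a similarity of ratio sqrt 3. It maps
   the triangular lattice onto the lattice of cell centres, and the six unit
   vectors onto the six steps between adjacent cells. *)
Definition center (p : point) : point := p + rot p.

Lemma rot_center p : rot (center p) = center (rot p).
Proof. by rewrite /center rotD. Qed.

Lemma across_center p k : across (center p) k = center (p + dir k).
Proof.
by rewrite /across /center dir_ordS rotD -!addrA; congr (_ + _); rewrite addrCA.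
Qed.

(** The hexagon of radius m about 0: as [ball_addir] and [ball_subdir] show, it
   is the ball of radius m for the graph distance of the triangular lattice. *)
Definition ball (m : nat) (p : point) : bool :=
  [&& `|p.1| <= m%:Z, `|p.2| <= m%:Z & `|p.1 + p.2| <= m%:Z].

Lemma ball_rot m p : ball m (rot p) = ball m p.
Proof.
by case: p => x y; rewrite /ball /=; apply/and3P/and3P => -[? ? ?]; split; lia.
Qed.

Ltac dir_cases k := case: k => -[|[|[|[|[|[|//]]]]]] ?.

Lemma ball_addir m p k : ball m p -> ball m.+1 (p + dir k).
Proof.
case: p => x y /and3P[/= ? ? ?].
by apply/and3P; dir_cases k; rewrite /dir /tnth /=; split; lia.
Qed.

(** A step towards 0 decreases the distance from 0; the signs of the coordinates
   of a nonzero point tell which unit vector to subtract. *)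
Lemma ball_subdir m p : ball m.+1 p -> ball m p \/ exists k, ball m (p - dir k).
Proof.
case: p => x y /and3P[/= hx hy hxy].
have toward k : ball m ((x, y) - dir k) ->
    ball m (x, y) \/ exists k, ball m ((x, y) - dir k).
  by right; exists k.
have [x0|x0|x0] := ltgtP x 0; have [y0|y0|y0] := ltgtP y 0.
- by apply: (toward (@Ordinal 6 3 isT)); apply/and3P; split=> /=; lia.
- by apply: (toward (@Ordinal 6 2 isT)); apply/and3P; split=> /=; lia.
- by apply: (toward (@Ordinal 6 3 isT)); apply/and3P; split=> /=; lia.
- by apply: (toward (@Ordinal 6 5 isT)); apply/and3P; split=> /=; lia.
- by apply: (toward (@Ordinal 6 0 isT)); apply/and3P; split=> /=; lia.
- by apply: (toward (@Ordinal 6 0 isT)); apply/and3P; split=> /=; lia.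
- by apply: (toward (@Ordinal 6 4 isT)); apply/and3P; split=> /=; lia.
- by apply: (toward (@Ordinal 6 1 isT)); apply/and3P; split=> /=; lia.
- by left; apply/and3P; split=> /=; lia.
Qed.

Lemma cellsP m h :
  reflect (exists2 p, ball m p & h = center p) (h \in cells m.+1).
Proof.
rewrite /cells /=; elim: m h => [|m IHm] h.
  rewrite inE; apply: (iffP eqP) => [->|[[x y] /and3P[/= x0 y0 _] ->]].
    by exists (0, 0).
  by congr pair; rewrite /=; lia.
rewrite /= {1}/add_layer mem_cat; apply: (iffP orP).
  case=> [/IHm[p bp ->]|/allpairsPdep[_ [k [/IHm[p bp ->] _ ->]]]].
    by exists p => //; case/and3P: bp => ? ? ?; apply/and3P; split; lia.
  by exists (p + dir k); rewrite ?across_center ?ball_addir.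
case=> p /ball_subdir[bp|[k bp]] ->; first by left; apply/IHm; exists p.
right; apply/allpairsPdep; exists (center (p - dir k)), k.
rewrite mem_enum across_center subrK; split=> //.
by apply/IHm; exists (p - dir k).
Qed.

Lemma cells_rot n h : h \in cells n -> rot h \in cells n.
Proof.
have -> : cells n = cells n.-1.+1 by [].
move=> /cellsP[p bp ->]; apply/cellsP.
by exists (rot p); rewrite ?ball_rot // rot_center.
Qed.

Section Rotation.
Variable n : nat.

Definition corners : seq point := [seq corner h k | h <- cells n, k <- enum 'I_6].

(** The relation of [hc_side] and, next, that of [hc_adj], on all points rather
   than on vertices: rotations act on points. *)
Definition side (p q : point) : bool :=
  has (fun h => [exists k, (p == corner h k) && (q == corner h (ordS k))]) (cells n).

Definition nbr (p q : point) : bool := side p q || side q p.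

Lemma sideP p q :
  reflect (exists h k, [/\ h \in cells n, p = corner h k & q = corner h (ordS k)])
          (side p q).
Proof.
apply: (iffP hasP) => [[h hn /existsP[k /andP[/eqP-> /eqP->]]]|[h [k [hn -> ->]]]].
  by exists h, k.
by exists h => //; apply/existsP; exists k; rewrite !eqxx.
Qed.

Lemma cornersP p :
  reflect (exists h k, h \in cells n /\ p = corner h k) (p \in corners).
Proof.
apply: (iffP allpairsPdep) => [[h [k [hn _ ->]]]|[h [k [hn ->]]]]; exists h, k => //.
by rewrite mem_enum.
Qed.

Lemma nbr_corner p q : nbr p q -> q \in corners.
Proof.
move=> /orP[]/sideP[h [k [hn pE qE]]]; apply/cornersP; exists h.
  by exists (ordS k).
by exists k.
Qed.

Lemma corner_rot h k : rot (corner h k) = corner (rot h) (ordS k).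
Proof. by rewrite /corner rotD dir_ordS. Qed.

Lemma corners_rot p : p \in corners -> rot p \in corners.
Proof.
move=> /cornersP[h [k [hn ->]]]; apply/cornersP; exists (rot h), (ordS k).
by rewrite cells_rot ?corner_rot.
Qed.

Lemma side_rot p q : side p q -> side (rot p) (rot q).
Proof.
move=> /sideP[h [k [hn -> ->]]]; apply/sideP; exists (rot h), (ordS k).
by rewrite cells_rot ?corner_rot.
Qed.

Lemma nbr_rot p q : nbr (rot p) (rot q) = nbr p q.
Proof.
have rotN p' q' : nbr p' q' -> nbr (rot p') (rot q').
  by move=> /orP[] /side_rot s; rewrite /nbr s ?orbT.
have iter_rotN k p' q' : nbr p' q' -> nbr (iter k rot p') (iter k rot q').
  by move=> pq; elim: k => //= k /rotN.
apply/idP/idP => [|/rotN//].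
by move=> /(iter_rotN 5%N); rewrite -!iterSr !rot6.
Qed.

Lemma nbr_iter_rot k p q : nbr (iter k rot p) (iter k rot q) = nbr p q.
Proof. by elim: k => //= k IHk; rewrite nbr_rot. Qed.

(** Adjacent points are vertices, so degrees can be computed among points. *)
Lemma degree_nbr (u : honeycomb n) (s : seq point) :
  uniq s -> s =i nbr (val u) -> degree u = size s.
Proof.
move=> us sE; rewrite /degree cardE -(size_map val); apply/perm_size/uniq_perm => //.
  by rewrite (map_inj_uniq val_inj) enum_uniq.
move=> q; rewrite sE; apply/mapP/idP => [[v]|uq].
  by rewrite mem_enum inE => uv ->.
by exists (SeqSub (nbr_corner uq)); rewrite // mem_enum inE.
Qed.

End Rotation.

(** * The six sectors *)

(** The corner in the direction 1 of the cell with coordinates (a, - b), where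
   the cells are indexed through [center]. *)
Definition sector (a b : nat) : point := corner (center (a%:Z, - b%:Z)) ord0.

(** The neighbours of [sector a b] in the infinite tiling are in the directions
   2, 4 and 0. The first two lie on the cell of [sector a b] itself. Both cells
   along the edge in direction 0 have the first coordinate a + 1: they are
   outside the network when a = m, and otherwise (a + 1, - b) is inside. *)
Definition sector_nbrs (m a b : nat) : seq point :=
  let p := sector a b in
  [:: p + (-1, 1); p + (0, -1)] ++ (if (a < m)%N then [:: p + (1, 0)] else [::]).

Section Sectors.
Variable m : nat.

Lemma sectorE a b : sector a b = (a%:Z + b%:Z + 1, a%:Z - 2 * b%:Z).
Proof. by congr pair => /=; lia. Qed.

Lemma uniq_sector_nbrs a b : uniq (sector_nbrs m a b).
Proof.
by rewrite /sector_nbrs; case: ifP => _; rewrite /= !inE !(inj_eq (addrI _)).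
Qed.

Lemma size_sector_nbrs a b : size (sector_nbrs m a b) = ((a < m) + 2)%N.
Proof. by rewrite /sector_nbrs size_cat; case: ifP. Qed.

Lemma sector_nbrsP a b : (a <= m)%N -> (b <= m)%N ->
  sector_nbrs m a b =i nbr m.+1 (sector a b).
Proof.
move=> am bm q; rewrite /sector_nbrs /= [RHS]/in_mem /=.
have cell x y : ball m (x, y) -> center (x, y) \in cells m.+1.
  by move=> bxy; apply/cellsP; exists (x, y).
have east : (a < m)%N -> nbr m.+1 (sector a b) (sector a b + (1, 0)).
  move=> lt_am; apply/orP; left; apply/sideP.
  exists (center (a%:Z + 1, - b%:Z)), (@Ordinal 6 4 isT); split.
  - by apply: cell; apply/and3P; split=> /=; lia.
  - by rewrite sectorE; congr pair => /=; lia.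
  - by rewrite sectorE; congr pair => /=; lia.
have west : nbr m.+1 (sector a b) (sector a b + (-1, 1)).
  apply/orP; left; apply/sideP.
  exists (center (a%:Z, - b%:Z)), (@Ordinal 6 0 isT); split.
  - by apply: cell; apply/and3P; split=> /=; lia.
  - by rewrite sectorE; congr pair => /=; lia.
  - by rewrite sectorE; congr pair => /=; lia.
have south : nbr m.+1 (sector a b) (sector a b + (0, -1)).
  apply/orP; right; apply/sideP.
  exists (center (a%:Z, - b%:Z)), (@Ordinal 6 5 isT); split.
  - by apply: cell; apply/and3P; split=> /=; lia.
  - by rewrite sectorE; congr pair => /=; lia.
  - by rewrite sectorE; congr pair => /=; lia.
apply/idP/idP => [|].
  rewrite !inE => /or3P[/eqP->|/eqP->|] //.
  by case: ifP => // lt_am; rewrite inE => /eqP->; apply: east.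
have listed d : q = sector a b + d ->
  [|| d == (-1, 1), d == (0, -1) | (d == (1, 0)) && (a < m)%N] ->
  q \in [:: sector a b + (-1, 1), sector a b + (0, -1)
         & if (a < m)%N then [:: sector a b + (1, 0)] else [::]].
  by move=> -> /or3P[/eqP->|/eqP->|/andP[/eqP-> ->]]; rewrite !inE eqxx ?orbT.
rewrite sectorE in listed *.
case: q listed => qx qy listed.
(* The odd directions k are impossible: modulo 3, corners in odd directions
   differ from those in even directions. *)
by move=> /orP[]/sideP[_ [k [/cellsP[[x y] /and3P[/= ? ? ?] ->]]]];
  dir_cases k => -[? ?] -[? ?];
  first [exfalso; lia
  | apply: (listed (-1, 1)) => //; congr pair => /=; lia
  | apply: (listed (0, -1)) => //; congr pair => /=; lia
  | apply: (listed (1, 0));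
      [congr pair => /=; lia | apply/or3P/Or33; rewrite eqxx /=; lia]].
Qed.

Definition place (t : 'I_6 * 'I_m.+1 * 'I_m.+1) : point :=
  iter t.1.1 rot (sector t.1.2 t.2).

Lemma place_corner t : place t \in corners m.+1.
Proof.
rewrite /place; elim: (t.1.1 : nat) => [|k IHk] /=; last exact: corners_rot.
apply/cornersP; exists (center ((t.1.2 : nat)%:Z, - (t.2 : nat)%:Z)), ord0; split=> //.
apply/cellsP; exists ((t.1.2 : nat)%:Z, - (t.2 : nat)%:Z) => //.
have := ltn_ord t.1.2; have := ltn_ord t.2.
by move=> ? ?; apply/and3P; split=> /=; lia.
Qed.

Lemma place_inj : injective place.
Proof.
move=> [[k a] b] [[k' a'] b']; rewrite /place /= !sectorE.
have := ltn_ord a; have := ltn_ord b; have := ltn_ord a'; have := ltn_ord b'.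
move=> hb' ha' hb ha E.
suff [-> [-> ->]] : k = k' /\ a = a' /\ b = b' by [].
move: E.
dir_cases k; dir_cases k' => /= -[E1 E2]; try (exfalso; lia).
all: split; [exact: val_inj | split; apply: val_inj => /=; lia].
Qed.

Lemma place_rot t j : exists t', place t' = iter j rot (place t).
Proof.
elim: j => [|j [[[k a] b] IHj]]; first by exists t.
by exists (ordS k, a, b); rewrite /= -IHj; move: IHj => _;
  dir_cases k; first [exact: erefl | exact: esym (rot6 _)].
Qed.

(** The corners of the network in the direction 1 are those of three sectors:
   the rotations by 0, 2 and 4 preserve the class modulo 3 of a corner. *)
Lemma sector_surj p : ball m p -> exists t, place t = corner (center p) ord0.
Proof.
case: p => x y /and3P[/= hx hy hxy].
have sector_at (j : 'I_6) (a b : int) : 0 <= a -> 0 <= b -> a <= m%:Z -> b <= m%:Z ->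
    iter j rot (a + b + 1, a - 2 * b) = corner (center (x, y)) ord0 ->
  exists t, place t = corner (center (x, y)) ord0.
  case: a => // a; case: b => // b _ _ am bm <-.
  have a_lt : (a < m.+1)%N by lia.
  have b_lt : (b < m.+1)%N by lia.
  by exists (j, Ordinal a_lt, Ordinal b_lt); rewrite /place /= sectorE.
(* The coordinates a and b solve the equation of corners for each of the three
   rotations; the inequalities on x and y say when they are nonnegative. *)
have [x_ge0|x_lt0] := leP 0 x; have [y_le0|y_gt0] := leP y 0.
- apply: (sector_at (@Ordinal 6 0 isT) x (- y)); try lia.
  by congr pair => /=; lia.
- apply: (sector_at (@Ordinal 6 2 isT) (y - 1) (x + y)); try lia.
  by congr pair => /=; lia.
- apply: (sector_at (@Ordinal 6 4 isT) (- x - y - 1) (- x - 1)); try lia.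
  by congr pair => /=; lia.
have [xy_ge0|xy_lt0] := leP 0 (x + y).
- apply: (sector_at (@Ordinal 6 2 isT) (y - 1) (x + y)); try lia.
  by congr pair => /=; lia.
- apply: (sector_at (@Ordinal 6 4 isT) (- x - y - 1) (- x - 1)); try lia.
  by congr pair => /=; lia.
Qed.

Lemma place_surj p : p \in corners m.+1 -> exists t, place t = p.
Proof.
move=> /cornersP[_ [k [/cellsP[q bq ->] ->]]].
(* Rotating by 6 - k turns a corner in the direction k into one in the
   direction 0. *)
have [t tE] : exists t, place t = corner (center (iter (6 - k) rot q)) ord0.
  apply: sector_surj; elim: (6 - k)%N => //= j.
  by rewrite ball_rot.
have [t' t'E] := place_rot t k; exists t'; rewrite t'E tE /corner iter_rotD -dir_iter.
congr (_ + _).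
have iter_center j p' : iter j rot (center p') = center (iter j rot p').
  by elim: j => //= j ->; rewrite rot_center.
by rewrite iter_center -iterD subnKC ?rot6 // ltnW.
Qed.

Definition vertex_at (t : 'I_6 * 'I_m.+1 * 'I_m.+1) : honeycomb m.+1 :=
  SeqSub (place_corner t).

Lemma vertex_at_bij : bijective vertex_at.
Proof.
apply: inj_card_bij => [t t' /(congr1 val)/place_inj //|].
rewrite -(card_codom (f := vertex_at)) => [|t t' /(congr1 val)/place_inj //].
apply/subset_leq_card/subsetP => u _.
have [t tE] := place_surj (valP u).
by apply/codomP; exists t; apply: val_inj.
Qed.

Lemma degree_vertex_at t : degree (vertex_at t) = ((t.1.2 < m) + 2)%N.
Proof.
case: t => -[k a] b; rewrite -(size_sector_nbrs a b) -(size_map (iter k rot)).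
have rot_bij : bijective (iter k rot).
  elim: (k : nat) => [|j IHj]; first by exists id.
  apply: (bij_comp (f := rot)) IHj; exists (iter 5 rot) => p; exact: rot6.
have [g rotK gK] := rot_bij.
apply: degree_nbr.
  by rewrite map_inj_uniq ?uniq_sector_nbrs //; apply: can_inj rotK.
move=> q; rewrite -(gK q) (mem_map (can_inj rotK)).
rewrite (sector_nbrsP (leq_ord a) (leq_ord b)).
exact/esym/nbr_iter_rot.
Qed.

End Sectors.

(** * Counting vertices and edges *)

Section Counting.
Variable m : nat.

Lemma honeycomb_degree23 (u : honeycomb m.+1) :
  (degree u == 2%N) || (degree u == 3%N).
Proof.
have [g _ gK] := vertex_at_bij m.
by rewrite -(gK u) degree_vertex_at; case: (_ < _)%N.
Qed.

Lemma sum_honeycomb_degrees (f : nat -> nat) :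
  (\sum_(u : honeycomb m.+1) f (degree u)
     = 6 * m.+1 * f 2 + 6 * m * m.+1 * f 3)%N.
Proof.
rewrite (reindex _ (onW_bij _ (vertex_at_bij m))) /=.
under eq_bigr do rewrite degree_vertex_at.
rewrite -(pair_bigA _ (fun (ka : 'I_6 * 'I_m.+1) (_ : 'I_m.+1) =>
  f ((ka.2 < m) + 2)%N)) /=.
under eq_bigr do rewrite sum_nat_const card_ord.
rewrite -(pair_bigA _ (fun (_ : 'I_6) (a : 'I_m.+1) => m.+1 * f ((a < m) + 2))%N) /=.
rewrite sum_nat_const card_ord big_ord_recr /= ltnn add0n.
under eq_bigr do rewrite ltn_ord.
rewrite sum_nat_const card_ord; ring.
Qed.

Lemma card_honeycomb_degree2 :
  #|[set u : honeycomb m.+1 | degree u == 2%N]| = (6 * m.+1)%N.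
Proof.
rewrite -sum1dep_card big_mkcond (sum_honeycomb_degrees (fun d => d == 2%N)) /=.
by rewrite muln1 muln0 addn0.
Qed.

Lemma card_honeycomb_edges :
  #|edges (honeycomb m.+1)| = (9 * m.+1 ^ 2 - 3 * m.+1)%N.
Proof.
have halve E : (2 * E = 6 * m.+1 * 2 + 6 * m * m.+1 * 3 ->
  E = 9 * m.+1 ^ 2 - 3 * m.+1)%N by lia.
exact: halve (etrans (handshake _) (sum_honeycomb_degrees id)).
Qed.

End Counting.

(** * The indices of the oxide network *)

Theorem theorem2p4p1 (R : realType) (n : nat) (alpha c : R) (hn : (1 <= n)%N) :
  [/\ Pi1 (oxide n) c = 2 `^ (18 * n%:R ^+ 2 * c),
      Pi2 (oxide n) = (2 ^ (72 * n ^ 2 - 12 * n))%N,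
      chi (oxide n) alpha =
        n%:R * 2 `^ (alpha + 2) * 3 `^ (alpha + 1)
        + 3 * n%:R * (3 * n%:R - 2) * 2 `^ (3 * alpha + 1) &
      Pi1star (oxide n) = (2 ^ (54 * n ^ 2 - 24 * n) * 3 ^ (12 * n))%N].
Proof.
case: n hn => // m _.
have d24 := oxide_degree24 (@honeycomb_degree23 m).
have indep := oxide_degree2_indep (@honeycomb_degree23 m).
have card2 := card_oxide_degree2 (@honeycomb_degree23 m).
have card4 := card_oxide_degree4 (@honeycomb_degree23 m).
rewrite card_honeycomb_degree2 in card2; rewrite card_honeycomb_edges in card4.
have pow6 k : (6 ^ k = 2 ^ k * 3 ^ k)%N by rewrite -expnMn.
have pow8 k : (8 ^ k = 2 ^ (3 * k))%N by rewrite expnM.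
have pow16 k : (16 ^ k = 2 ^ (4 * k))%N by rewrite expnM.
split.
- rewrite /Pi1 (big_degree24 d24 _ (fun d => d%:R `^ c)) /=.
  rewrite card2 card4 !iter_mulr_1.
  have -> : 4 = 2 * 2 :> R by ring.
  rewrite powRM // -expr2 -exprM -exprD -(powR_mulrn _ (powR_ge0 2 c)) -powRrM mulrC.
  have -> : (6 * m.+1 + 2 * (9 * m.+1 ^ 2 - 3 * m.+1) = 18 * m.+1 ^ 2)%N by lia.
  by rewrite natrM natrX.
- rewrite /Pi2 (@big_edges24 _ d24 indep _ _ _ _ 8%N 16%N) =>
    [|x y xy dx dy|x y xy dx dy]; [|by rewrite big_edge // dx dy..].
  rewrite /= card2 card4 !iter_muln_1 pow8 pow16 -expnD.
  by congr (2 ^ _)%N; lia.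
- rewrite /chi (@big_edges24 _ d24 indep _ _ _ _ (6 `^ alpha) (8 `^ alpha)) =>
    [|x y xy dx dy|x y xy dx dy]; [|by rewrite big_edge // dx dy..].
  rewrite /= card2 card4 !iter_addr_0.
  have shift (a x : R) k : 0 < a -> a `^ (x + k%:R) = a `^ x * a ^+ k.
    by move=> a0; rewrite powRD ?(gt_eqF a0) ?implybT // powR_mulrn // ltW.
  (* Both sides become combinations of 6 `^ alpha and 8 `^ alpha. *)
  rewrite (shift 2 alpha 2%N) // (shift 3 alpha 1%N : _ -> 3 `^ (alpha + 1) = _) //.
  rewrite (shift 2 (3 * alpha) 1%N : _ -> 2 `^ (3 * alpha + 1) = _) //.
  rewrite [2 `^ (3 * alpha)]powRrM (powR_mulrn 3) //.
  have -> : 2 ^+ 3 = 8 :> R by ring.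
  have -> : 6 = 2 * 3 :> R by ring.
  rewrite powRM //.
  have -> : (2 * (9 * m.+1 ^ 2 - 3 * m.+1) - 6 * m.+1
             = 6 * m.+1 * (3 * m + 1))%N by lia.
  rewrite -[_ *+ (2 * _)]mulr_natr -[X in _ + X]mulr_natr.
  by rewrite !natrM natrD !natrM -natr1; ring.
- rewrite /Pi1star (@big_edges24 _ d24 indep _ _ _ _ 6%N 8%N) =>
    [|x y xy dx dy|x y xy dx dy]; [|by rewrite big_edge // dx dy..].
  rewrite /= card2 card4 !iter_muln_1 pow8 pow6 mulnAC -expnD.
  by congr (2 ^ _ * 3 ^ _)%N; lia.
Qed.
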